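(* Let $\gamma>1$ and let $\mathcal{O}$ be an oracle which, given linearly independent vectors $\mathbf{B}\in\mathbb{Q}^{m\times n}$, returns an elementary vector $\mathbf{v}\in\mathcal{L}(\mathbf{B})$ with $0<\|\mathbf{v}\|\le\gamma\lambda_1(\mathcal{L}(\mathbf{B}))$. Consider the recursive procedure $\mathrm{CVP}(\mathbf{B},\mathbf{t})$ on input a basis $\mathbf{B}\in\mathbb{Q}^{m\times n}$ and a target $\mathbf{t}\in\mathbb{Q}^m$: (i) If $n=1$, with $\mathbf{b}_1$ the only column of $\mathbf{B}$, return $a\mathbf{b}_1$ for an $a\in\mathbb{Z}$ minimizing $\|a\mathbf{b}_1-\mathbf{t}\|$. (ii) Otherwise: let $\mathbf{z}_1\in\mathcal{L}(\mathbf{B})$ be the output of a subroutine which, whenever $\mathrm{dist}(\mathbf{t},\mathcal{L}(\mathbf{B}))\le\lambda_1(\mathbf{B})/(2\gamma)$, returns a lattice vector $\mathbf{z}_1$ with $\|\mathbf{z}_1-\mathbf{t}\|=\mathrm{dist}(\mathbf{t},\mathcal{L}(\mathbf{B}))$ (and otherwise returns some lattice vector). Let $\mathbf{v}\gets\mathcal{O}(\mathbf{B})$. Compute vectors $\mathbf{b}_2,\ldots,\mathbf{b}_n$ such that $\mathcal{L}(\mathbf{v},\mathbf{b}_2,\ldots,\mathbf{b}_n)=\mathcal{L}(\mathbf{B})$. Let $\mathbf{B}'_{\perp\mathbf{v}}$ be the basis $\{(\mathbf{b}_2)_{\perp\mathbf{v}},\ldots,(\mathbf{b}_n)_{\perp\mathbf{v}}\}$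 and $\mathbf{t}_{\perp\mathbf{v}}$ the projection of $\mathbf{t}$, and recursively compute $\mathbf{z}'_2\gets\mathrm{CVP}(\mathbf{B}'_{\perp\mathbf{v}},\mathbf{t}_{\perp\mathbf{v}})$. Write $\mathbf{z}'_2=\sum_{i=2}^n a_i(\mathbf{b}_i)_{\perp\mathbf{v}}$ with $a_i\in\mathbb{Z}$, choose $a_1\in\mathbb{Z}$ such that $\mathbf{z}_2=a_1\mathbf{v}+\sum_{i=2}^n a_i\mathbf{b}_i$ is closest to $\mathbf{t}$, and return whichever of $\mathbf{z}_1,\mathbf{z}_2$ is closer to $\mathbf{t}$. Then the procedure outputs a vector $\mathbf{z}\in\mathcal{L}(\mathbf{B})$ with $\|\mathbf{z}-\mathbf{t}\|\le\gamma^2\sqrt{n}\,\mathrm{dist}(\mathbf{t},\mathcal{L}(\mathbf{B}))$.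
   Context: A lattice basis is a set of linearly independent vectors $\mathbf{b}_1,\ldots,\mathbf{b}_n\in\mathbb{Q}^m$ (columns of $\mathbf{B}$), and $\mathcal{L}(\mathbf{B})=\{\mathbf{B}x:x\in\mathbb{Z}^n\}$. Norms are Euclidean. $\lambda_1(\mathbf{B})$ is the length of a shortest nonzero lattice vector; $\mathrm{dist}(\mathbf{t},\mathcal{L}(\mathbf{B}))$ is the distance from $\mathbf{t}$ to the nearest lattice point. A lattice vector is elementary if it is not a nontrivial integer multiple of another lattice vector. For vectors $\mathbf{u},\mathbf{v}$ with $\mathbf{v}\ne0$, $\mathbf{u}|_{\mathbf{v}}=\frac{\langle\mathbf{u},\mathbf{v}\rangle}{\langle\mathbf{v},\mathbf{v}\rangle}\mathbf{v}$ and $\mathbf{u}_{\perp\mathbf{v}}=\mathbf{u}-\mathbf{u}|_{\mathbf{v}}$. *)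

(* Defs.v *)
From mathcomp Require Import all_boot all_order all_algebra.
From mathcomp Require Import boolp classical_sets reals.

Set Implicit Arguments.
Unset Strict Implicit.
Unset Printing Implicit Defensive.

Import Order.TTheory GRing.Theory Num.Theory.

Local Open Scope classical_set_scope.
Local Open Scope ring_scope.

Definition dotp m (u v : 'cV[rat]_m) : rat := \sum_i u i 0 * v i 0.

Definition enorm (R : realType) m (u : 'cV[rat]_m) : R :=
  Num.sqrt (ratr (dotp u u)).

Definition proj m (v u : 'cV[rat]_m) : 'cV[rat]_m :=
  (dotp u v / dotp v v) *: v.

Definition perp m (v u : 'cV[rat]_m) : 'cV[rat]_m := u - proj v u.

Definition perp_cols m n (v : 'cV[rat]_m) (A : 'M[rat]_(m, n)) :
    'M[rat]_(m, n) :=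
  \matrix_(i, j) perp v (col j A) i 0.

(* Basis vectors are the columns of B. *)
Definition lattice_basis m n (B : 'M[rat]_(m, n)) : Prop := row_free B^T.

Definition lattice m n (B : 'M[rat]_(m, n)) : set 'cV[rat]_m :=
  range (fun x : 'cV[int]_n => B *m map_mx intr x).

(* Lattices are discrete, so for a basis with at least one vector the infima
   in lambda1 and dist are attained minima. *)
Definition lambda1 (R : realType) m n (B : 'M[rat]_(m, n)) : R :=
  inf [set enorm R w | w in lattice B `\ 0].

Definition dist (R : realType) m n (t : 'cV[rat]_m) (B : 'M[rat]_(m, n)) : R :=
  inf [set enorm R (w - t) | w in lattice B].

(* The trivial multiples are those by 1 and -1; the multiple by 0 only
   concerns v = 0, which is not elementary, being 2 * 0. *)
Definition elementary m n (B : 'M[rat]_(m, n)) (v : 'cV[rat]_m) : Prop :=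
  lattice B v /\
  ~ exists (w : 'cV[rat]_m) (k : int), [/\ lattice B w, 1 < `|k| & v = w *~ k].

(* Bases have n.+1 vectors: the empty basis has no nonzero lattice vector. *)
Definition short_vector_oracle (R : realType) (gamma : R)
    (O : forall m n, 'M[rat]_(m, n.+1) -> 'cV[rat]_m) : Prop :=
  forall m n (B : 'M[rat]_(m, n.+1)), lattice_basis B ->
    elementary B (O m n B) /\
    0 < enorm R (O m n B) <= gamma * lambda1 R B.

Definition bounded_distance_decoder (R : realType) (gamma : R)
    (D : forall m n, 'M[rat]_(m, n.+1) -> 'cV[rat]_m -> 'cV[rat]_m) : Prop :=
  forall m n (B : 'M[rat]_(m, n.+1)) (t : 'cV[rat]_m), lattice_basis B ->
    lattice B (D m n B t) /\
    (dist R t B <= lambda1 R B / (2 * gamma) ->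
     enorm R (D m n B t - t) = dist R t B).

(* [cvp_output R O D B t z]: some execution of the recursive procedure with
   oracle O and decoder D, on input (B, t), returns z.  The procedure leaves
   several choices open (b_2, ..., b_n, the minimizing integers, ties), so it is
   a relation between inputs and outputs. *)
Fixpoint cvp_output (R : realType)
    (O : forall m n, 'M[rat]_(m, n.+1) -> 'cV[rat]_m)
    (D : forall m n, 'M[rat]_(m, n.+1) -> 'cV[rat]_m -> 'cV[rat]_m)
    (m n : nat) {struct n} :
    'M[rat]_(m, n.+1) -> 'cV[rat]_m -> 'cV[rat]_m -> Prop :=
  match n return 'M[rat]_(m, n.+1) -> 'cV[rat]_m -> 'cV[rat]_m -> Prop with
  | 0 => fun B t z =>
      exists a : int,
        (forall c : int,
           enorm R (col 0 B *~ a - t) <= enorm R (col 0 B *~ c - t)) /\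
        z = col 0 B *~ a
  | n'.+1 => fun B t z =>
      let z1 := D m n'.+1 B t in
      let v := O m n'.+1 B in
      exists (bs : 'M[rat]_(m, n'.+1)) (z2' : 'cV[rat]_m)
             (a : 'cV[int]_n'.+1) (a1 : int),
        let lift (c : int) := v *~ c + bs *m map_mx intr a in
        let z2 := lift a1 in
        [/\ lattice (row_mx v bs) = lattice B,
            cvp_output R O D (perp_cols v bs) (perp v t) z2',
            z2' = perp_cols v bs *m map_mx intr a,
            forall c : int, enorm R (z2 - t) <= enorm R (lift c - t) &
            (z = z1 /\ enorm R (z1 - t) <= enorm R (z2 - t)) \/
            (z = z2 /\ enorm R (z2 - t) <= enorm R (z1 - t))]
  end.

(* Main.v *)
(* Induction on the rank.  If t lies within lambda_1 / (2 gamma) of the lattice,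
   the decoder's answer is optimal.  Otherwise |v| <= gamma lambda_1 < 2 gamma^2 d
   where d = dist(t, L).  Rounding along v costs at most |v| / 2, and projecting
   orthogonally to v does not increase d, so by Pythagoras and induction
   |z_2 - t|^2 <= gamma^4 (n - 1) d^2 + |v|^2 / 4 <= gamma^4 n d^2.
   That an execution exists at all rests on extending the primitive vector v to
   a lattice basis, via the Smith normal form of its coordinate column. *)
Require Import Defs.
From mathcomp Require Import all_boot all_order all_algebra.
From mathcomp Require Import boolp classical_sets reals.
From mathcomp Require Import zify ring lra.

Import Order.TTheory GRing.Theory Num.Theory.
Local Open Scope ring_scope.

Set Implicit Arguments.
Unset Strict Implicit.

(** * Inner products and orthogonal projection over the rationals *)

Section Dot.
Variable m : nat.
Implicit Types u v w t : 'cV[rat]_m.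

Lemma dotpDl u v w : dotp (u + v) w = dotp u w + dotp v w.
Proof.
by rewrite /dotp -big_split; apply: eq_bigr => i _; rewrite mxE mulrDl.
Qed.

Lemma dotpZl k u w : dotp (k *: u) w = k * dotp u w.
Proof.
by rewrite /dotp big_distrr; apply: eq_bigr => i _; rewrite mxE -mulrA.
Qed.

Lemma dotpC u v : dotp u v = dotp v u.
Proof. by apply: eq_bigr => i _; rewrite mulrC. Qed.

Lemma dotpDr u v w : dotp w (u + v) = dotp w u + dotp w v.
Proof. by rewrite dotpC dotpDl !(dotpC w). Qed.

Lemma dotpZr k u w : dotp w (k *: u) = k * dotp w u.
Proof. by rewrite dotpC dotpZl (dotpC w). Qed.

Lemma dotp_ge0 u : 0 <= dotp u u.
Proof. by apply: sumr_ge0 => i _; rewrite -expr2 sqr_ge0. Qed.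

Lemma dotp_eq0 u : (dotp u u == 0) = (u == 0).
Proof.
apply/eqP/eqP => [/eqP|->]; last first.
  by apply: big1 => i _; rewrite mxE mul0r.
rewrite psumr_eq0 => [/allP u0|i _]; last by rewrite -expr2 sqr_ge0.
apply/colP => i; have := u0 i (mem_index_enum i).
by rewrite /= mulf_eq0 orbb mxE => /eqP.
Qed.

Lemma perpE v u : perp v u = u + (- (dotp u v / dotp v v)) *: v.
Proof. by rewrite /perp /proj scaleNr. Qed.

Lemma pythagoras v u : v != 0 ->
  dotp u u = dotp (perp v u) (perp v u) + (dotp u v / dotp v v) ^+ 2 * dotp v v.
Proof.
rewrite -dotp_eq0 => v0; rewrite perpE !(dotpDl, dotpDr, dotpZl, dotpZr).
by rewrite (dotpC v u); field.
Qed.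

Lemma perpD v u w : perp v (u + w) = perp v u + perp v w.
Proof. by rewrite /perp /proj dotpDl mulrDl scalerDl opprD addrACA. Qed.

Lemma perpZ v k u : perp v (k *: u) = k *: perp v u.
Proof. by rewrite /perp /proj dotpZl -mulrA -scalerA -scalerBr. Qed.

Lemma perpB v u w : perp v (u - w) = perp v u - perp v w.
Proof. by rewrite -[- w]scaleN1r perpD perpZ scaleN1r. Qed.

Lemma perp_id v : v != 0 -> perp v v = 0.
Proof.
by rewrite -dotp_eq0 => v0; rewrite /perp /proj divff // scale1r subrr.
Qed.

Lemma dotp_perp_le v u : v != 0 -> dotp (perp v u) (perp v u) <= dotp u u.
Proof.
move=> v0; rewrite [leRHS](pythagoras _ v0) lerDl.
by rewrite mulr_ge0 ?sqr_ge0 ?dotp_ge0.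
Qed.

(** The component orthogonal to [v] does not depend on [c], so finding the closest point on a line
    is a one-dimensional rounding problem. *)
Lemma dotp_line v w (c : int) : v != 0 ->
  dotp (v *~ c + w) (v *~ c + w) =
  dotp (perp v w) (perp v w) + (c%:~R + dotp w v / dotp v v) ^+ 2 * dotp v v.
Proof.
move=> v0; rewrite [LHS](pythagoras _ v0) -scaler_int perpD perpZ perp_id //.
rewrite scaler0 add0r (dotpDl (_ *: _)) dotpZl mulrDl mulfK // ?dotp_eq0 //.
Qed.

(** By linearity of the projection; hence the lattice spanned by the projected columns is the
    projection of the lattice spanned by [A]. *)
Lemma perp_cols_mul n v (A : 'M[rat]_(m, n)) (x : 'cV[rat]_n) :
  perp_cols v A *m x = perp v (A *m x).
Proof.
have mulE (C : 'M[rat]_(m, n)) : C *m x = \sum_j x j 0 *: col j C.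
  apply/colP => i; rewrite mxE summxE.
  by apply: eq_bigr => j _; rewrite !mxE mulrC.
rewrite !mulE; have -> : forall F : 'I_n -> 'cV_m,
    perp v (\sum_j F j) = \sum_j perp v (F j).
  move=> F; apply: (big_morph (perp v)) => [u w|]; first exact: perpD.
  by rewrite -(scale0r 0) perpZ !scale0r.
apply: eq_bigr => j _; rewrite perpZ; congr (_ *: _).
by apply/colP => i; rewrite !mxE.
Qed.

End Dot.

(** * Rounding along a line, and distance to a lattice *)

Lemma nearest_int (F : archiRealFieldType) (s : F) :
  exists a : int, (a%:~R + s) ^+ 2 <= 4^-1 /\
    forall c : int, (a%:~R + s) ^+ 2 <= (c%:~R + s) ^+ 2.
Proof.
(* This puts a + s in (-1/2, 1/2]; moving to another integer shifts it by at least 1, so its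
   absolute value becomes at least 1/2. *)
set a := Num.floor (2^-1 - s); exists a.
have a_le : a%:~R <= 2^-1 - s := floor_le _.
have a_lt : 2^-1 - s < a%:~R + 1 by rewrite -[1]/(1%:~R) -intrD floorD1_gt.
split=> [|c]; first by nra.
have [ca|ac|->] := ltgtP c a => //.
- have : c%:~R + 1 <= a%:~R :> F by rewrite -[1]/(1%:~R) -intrD ler_int lezD1.
  by move=> ?; nra.
- have : a%:~R + 1 <= c%:~R :> F by rewrite -[1]/(1%:~R) -intrD ler_int lezD1.
  by move=> ?; nra.
Qed.

Section Norm.
Variable (R : realType) (m : nat).
Implicit Types u v w t : 'cV[rat]_m.

Lemma enorm_le u v : (enorm R u <= enorm R v) = (dotp u u <= dotp v v).
Proof. by rewrite ler_sqrt ?ler_rat // ler0q dotp_ge0. Qed.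

Lemma enorm_ge0 u : 0 <= enorm R u.
Proof. exact: sqrtr_ge0. Qed.

Lemma sqr_enorm u : enorm R u ^+ 2 = ratr (dotp u u).
Proof. by rewrite sqr_sqrtr // ler0q dotp_ge0. Qed.

Lemma closest_on_line v w : v != 0 ->
  exists a : int, forall c : int, enorm R (v *~ a + w) <= enorm R (v *~ c + w).
Proof.
move=> v0; have [a [_ amin]] := nearest_int (dotp w v / dotp v v).
exists a => c; rewrite enorm_le !dotp_line // lerD2l ler_wpM2r ?dotp_ge0 //.
Qed.

(** A minimizer does at least as well as the rounded coefficient, whose error along [v] is at most
    half of [v]. It is stated for every minimizer because the procedure leaves ties open. *)
Lemma closest_on_line_le v w (a : int) : v != 0 ->
    (forall c : int, enorm R (v *~ a + w) <= enorm R (v *~ c + w)) ->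
  enorm R (v *~ a + w) ^+ 2 <= enorm R (perp v w) ^+ 2 + enorm R v ^+ 2 / 4.
Proof.
move=> v0 amin; have [c [c_le _]] := nearest_int (dotp w v / dotp v v).
have : dotp (v *~ a + w) (v *~ a + w) <=
    dotp (perp v w) (perp v w) + dotp v v / 4.
  have := amin c; rewrite enorm_le => /le_trans; apply.
  by rewrite dotp_line // lerD2l mulrC ler_wpM2l ?dotp_ge0.
rewrite !sqr_enorm -(ler_rat R) rmorphD rmorphM fmorphV.
by rewrite rmorph_nat.
Qed.

Lemma dist_le n t w (B : 'M[rat]_(m, n)) :
  lattice B w -> dist R t B <= enorm R (w - t).
Proof.
move=> Bw; apply: ge_inf; last by exists w.
by exists 0 => _ [u _ <-]; exact: enorm_ge0.
Qed.

Lemma lattice0 n (B : 'M[rat]_(m, n)) : lattice B 0.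
Proof. by exists 0 => //; rewrite map_mx0 mulmx0. Qed.

Lemma le_dist n t (r : R) (B : 'M[rat]_(m, n)) :
  (forall w, lattice B w -> r <= enorm R (w - t)) -> r <= dist R t B.
Proof.
move=> r_le; apply: lb_le_inf; last by move=> _ [w Bw <-]; exact: r_le.
(* The infimum of an empty set would be a default value; the zero vector shows that the set is
   nonempty. *)
by exists (enorm R (0 - t)), 0 => //; exact: lattice0.
Qed.

Lemma dist_ge0 n t (B : 'M[rat]_(m, n)) : 0 <= dist R t B.
Proof. by apply: le_dist => w _; exact: enorm_ge0. Qed.

End Norm.

(** * Lattice bases under change of basis and projection *)

Lemma lattice_basis_inj m n (B : 'M[rat]_(m, n)) : lattice_basis B <->
  forall x : 'cV_n, B *m x = 0 -> x = 0.
Proof.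
split=> [/row_free_inj Binj x Bx0|Binj].
  apply: trmx_inj; rewrite trmx0; apply: (Binj 1%N).
  by rewrite mul0mx -trmx_mul Bx0 trmx0.
apply: inj_row_free => x xB0; apply: trmx_inj; rewrite trmx0.
by apply: Binj; rewrite -[B]trmxK -trmx_mul xB0 trmx0.
Qed.

Lemma lattice_row_mxP m n (v : 'cV[rat]_m) (bs : 'M[rat]_(m, n)) w :
  lattice (row_mx v bs) w <->
  exists (c : int) (a : 'cV[int]_n), w = v *~ c + bs *m map_mx intr a.
Proof.
have intE (c : int) : v *m map_mx intr (c%:M : 'M_1) = v *~ c.
  by rewrite map_scalar_mx mul_mx_scalar scaler_int.
split=> [[x _ <-]|[c [a ->]]].
  exists (usubmx x 0 0), (dsubmx x).
  by rewrite -[x in LHS]vsubmxK map_col_mx mul_row_col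
    [usubmx x in LHS]mx11_scalar intE.
by exists (col_mx c%:M a) => //; rewrite map_col_mx mul_row_col intE.
Qed.

(** Every column of [B] is an integer combination of columns of [C], so B = C X with [X] square, and
    the rank of [C] is at least that of [B], which is full. *)
Lemma lattice_basis_eq m n (B C : 'M[rat]_(m, n)) :
  lattice C = lattice B -> lattice_basis B -> lattice_basis C.
Proof.
move=> CB Bbasis.
have [X BE] : exists X : 'M[rat]_n, B = C *m X.
  have colB j : exists x : 'cV[int]_n, col j B = C *m map_mx intr x.
    have : lattice B (col j B).
      exists (delta_mx j 0) => //; rewrite colE; congr (_ *m _).
      by apply/matrixP => i k; rewrite !mxE; do 2!case: eqP.
    by rewrite -CB => -[x _ <-]; exists x.
  have [x xE] := choice colB.
  exists (\matrix_(i, j) (x j i 0)%:~R); apply/matrixP => i j.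
  have /colP/(_ i) := xE j; rewrite !mxE => ->.
  by apply: eq_bigr => k _; rewrite !mxE.
move: Bbasis; rewrite /lattice_basis /row_free BE trmx_mul => /eqP rk.
by rewrite eqn_leq rank_leq_row -{1}rk mxrankM_maxr.
Qed.

(** A relation [x] among the projected columns lifts to one among [v] and [bs]: the coefficient of
    [v] is minus the projection coefficient of [bs *m x]. *)
Lemma perp_cols_basis m n (v : 'cV[rat]_m) (bs : 'M[rat]_(m, n)) :
  lattice_basis (row_mx v bs) -> lattice_basis (perp_cols v bs).
Proof.
move=> /lattice_basis_inj inj; apply/lattice_basis_inj => x.
rewrite perp_cols_mul perpE => bx.
have := inj (col_mx (- (dotp (bs *m x) v / dotp v v))%:M x).
rewrite mul_row_col mul_mx_scalar addrC => /(_ bx) /(congr1 dsubmx).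
by rewrite col_mxKd linear0.
Qed.

(** * Extending an elementary vector to a generating family of the lattice *)

Lemma elementary_neq0 m n (B : 'M[rat]_(m, n)) v : elementary B v -> v != 0.
Proof.
move=> [_ v_elem]; apply/eqP => v0; apply: v_elem.
by exists 0, 2; split; rewrite ?v0 ?mul0rz //; exact: lattice0.
Qed.

(** The Smith form of a column has a single diagonal entry, and its right factor is a 1 by 1 matrix;
    their product is [e], which is up to sign the gcd of the coordinates. *)
Lemma int_col_unimodular n (x : 'cV[int]_n.+1) :
  exists (L : 'M[int]_(1 + n)) (e : int), L \in unitmx /\ x = lsubmx L *m e%:M.
Proof.
have [L uL [U uU [d _ xE]]] := int_Smith_normal_form x.
exists L, (d`_0 * U 0 0); split=> //.
have -> : lsubmx (L : 'M_(1 + n)) *m (d`_0 * U 0 0)%:M =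
    (L : 'M_(1 + n)) *m col_mx (d`_0 * U 0 0)%:M 0.
  by rewrite -[L in RHS](@hsubmxK _ _ 1 n) mul_row_col mulmx0 addr0.
rewrite {1}xE -mulmxA; congr (_ *m _).
apply/matrixP => i j; rewrite (ord1 j) !mxE big_ord1 !mxE.
case: splitP => k ->; rewrite !mxE ?ord1 //= mulr0n mul0r //.
Qed.

Lemma elementary_extend m n (B : 'M[rat]_(m, n.+1)) v :
    elementary B v ->
  exists bs : 'M[rat]_(m, n), lattice (row_mx v bs) = lattice B.
Proof.
move=> v_elem; have v0 := elementary_neq0 v_elem.
case: v_elem => -[x _ vE] v_elem.
have [L [e [uL xE]]] := int_col_unimodular x.
pose y := B *m map_mx intr (lsubmx L).
have vyE : v = y *~ e.
  rewrite -vE xE /y map_mxM map_scalar_mx mulmxA mul_mx_scalar scaler_int //.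
(* Since [v] is [e] times the lattice vector [y], elementarity excludes |e| > 1, and v != 0 excludes
   e = 0. *)
have e_sqr : e * e = 1.
  have e0 : e != 0 by apply: contraNneq v0 => e0; rewrite vyE e0 mulr0z.
  have : ~~ (1 < `|e|).
    apply/negP => e1; apply: v_elem; exists y, e; split=> //.
    by exists (lsubmx L).
  by move: e0; nia.
have latE (c : int) (a : 'cV[int]_n) :
    v *~ c + B *m map_mx intr (rsubmx L) *m map_mx intr a =
    B *m map_mx intr (L *m col_mx (e * c)%:M a).
  rewrite -[L in RHS]hsubmxK mul_row_col map_mxD mulmxDr !map_mxM !mulmxA.
  by rewrite map_scalar_mx mul_mx_scalar -/y scaler_int vyE mulrzA_C mulrC.
(* The remaining columns of [B] times [L] complete [v], because [L] is invertible over the integers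
   and [v] is its first column up to the sign [e]. *)
exists (B *m map_mx intr (rsubmx L)).
apply/seteqP; split=> w.
  by case/lattice_row_mxP => c [a ->]; rewrite latE;
    exists (L *m col_mx (e * c)%:M a).
case=> z _ <-; apply/lattice_row_mxP.
pose z' : 'cV[int]_(1 + n) := invmx L *m z.
(* The factor [e] cancels the one in [latE], by [e_sqr]. *)
exists (e * usubmx z' 0 0), (dsubmx z').
by rewrite latE mulrA e_sqr mul1r -mx11_scalar vsubmxK mulKVmx.
Qed.

Theorem theorem3 (R : realType) (gamma : R)
    (O : forall m n : nat, 'M[rat]_(m, n.+1) -> 'cV[rat]_m)
    (D : forall m n : nat, 'M[rat]_(m, n.+1) -> 'cV[rat]_m -> 'cV[rat]_m)
    (hgamma : 1 < gamma)
    (hO : short_vector_oracle gamma O)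
    (hD : bounded_distance_decoder gamma D)
    (m n : nat) (B : 'M[rat]_(m, n.+1)) (t : 'cV[rat]_m)
    (hB : lattice_basis B) :
  (exists z : 'cV[rat]_m, cvp_output R O D B t z) /\
  (forall z : 'cV[rat]_m, cvp_output R O D B t z ->
     lattice B z /\
     enorm R (z - t) <= gamma ^+ 2 * Num.sqrt n.+1%:R * dist R t B).
Proof.
have gamma2_gt1 : 1 < gamma ^+ 2 by rewrite expr_gt1 // ltW // (lt_trans ltr01).
elim: n B t hB => [|n IH] B t hB.
  have multE w : lattice B w <-> exists c : int, w = col 0 B *~ c.
    (* An empty block is appended so that [lattice_row_mxP] applies in rank one. *)
    have BE : row_mx (col 0 B) (0 : 'M_(m, 0)) = B.
      apply/matrixP => i j; rewrite (ord1 j) mxE; case: splitP => [k _|[]] //.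
      by rewrite !mxE.
    rewrite -{1}BE; split.
      by case/lattice_row_mxP => c [a ->]; exists c; rewrite mul0mx addr0.
    by case=> c ->; apply/lattice_row_mxP; exists c, 0; rewrite mul0mx addr0.
  have b0 : col 0 B != 0.
    apply/eqP; rewrite colE => /(lattice_basis_inj B).1 -/(_ hB).
    by move/colP/(_ 0)/eqP; rewrite !mxE.
  split=> [|_ [a [amin ->]]].
    have [a amin] := closest_on_line R (- t) b0.
    by exists (col 0 B *~ a), a.
  split; first by apply/multE; exists a.
  (* In rank one the rounded multiple is an exact closest point, and the factor gamma^2 only weakens
     the bound. *)
  rewrite sqrtr1 mulr1; apply: (@le_trans _ _ (dist R t B)).
    by apply: le_dist => _ /multE [c ->].
  by rewrite ler_peMl ?dist_ge0 // ltW.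
have [v_elem /andP[_ v_le]] := hO _ _ _ hB.
have [z1_lat z1_closest] := hD _ _ _ t hB.
move: v_elem v_le; set v := O m n.+1 B => v_elem v_le.
have v0 := elementary_neq0 v_elem.
have bs_basis (bs : 'M_(m, n.+1)) : lattice (row_mx v bs) = lattice B ->
    lattice_basis (perp_cols v bs).
  by move=> latE; apply: perp_cols_basis; exact: lattice_basis_eq latE hB.
split=> [|z [bs [z2' [a [a1 [latE z2'_out z2'E a1_min z_choice]]]]]].
  have [bs latE] := elementary_extend v_elem.
  have [[z2' z2'_out] lat_out] := IH _ (perp v t) (bs_basis _ latE).
  (* The integer coordinates of [z2'] exist because recursive outputs are lattice vectors; this is
     why existence and correctness go through one induction. *)
  have [[a _ z2'E] _] := lat_out _ z2'_out.
  have [a1 a1_min] := closest_on_line R (bs *m map_mx intr a - t) v0.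
  have [z1_le|z2_le] := leP (enorm R (D m n.+1 B t - t))
    (enorm R (v *~ a1 + bs *m map_mx intr a - t)).
    exists (D m n.+1 B t), bs, z2', a, a1; split=> //; last by left.
    by move=> c; rewrite -!addrA.
  exists (v *~ a1 + bs *m map_mx intr a), bs, z2', a, a1; split=> //.
    by move=> c; rewrite -!addrA.
  by right; rewrite ltW.
set z2 := v *~ a1 + bs *m map_mx intr a in a1_min z_choice.
have z2_lat : lattice B z2.
  by rewrite -latE; apply/lattice_row_mxP; exists a1, a.
split; first by case: z_choice => -[-> _].
set d := dist R t B.
have d_ge0 : 0 <= d := dist_ge0 _ _ _.
have [z_le1 z_le2] : enorm R (z - t) <= enorm R (D m n.+1 B t - t) /\
    enorm R (z - t) <= enorm R (z2 - t).
  by case: z_choice => -[-> ?].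
have sqrt_ge1 : 1 <= Num.sqrt n.+2%:R :> R.
  by rewrite -[leLHS]sqrtr1 ler_sqrt ?ler1n ?ler0n.
have [close|far] := leP d (lambda1 R B / (2 * gamma)).
  apply: (le_trans z_le1); rewrite z1_closest // ler_peMl //.
  by rewrite mulr_ege1 // ltW.
apply: (le_trans z_le2).
have v_lt : enorm R v <= gamma ^+ 2 * 2 * d.
  apply: (le_trans v_le); move: far.
  rewrite ltr_pdivrMr; last by lra.
  by move=> /ltW; nra.
(* Projecting a lattice point kills its [v] component and lands in the projected lattice, while the
   difference with [t] does not get longer. *)
have d'_le : dist R (perp v t) (perp_cols v bs) <= d.
  apply: le_dist => w; rewrite -latE => /lattice_row_mxP [c [x ->]].
  apply: (@le_trans _ _ (enorm R (perp v (v *~ c + bs *m map_mx intr x - t)))).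
    rewrite perpB perpD -scaler_int perpZ perp_id // scaler0 add0r.
    by rewrite -perp_cols_mul; apply: dist_le; exists x.
  by rewrite enorm_le dotp_perp_le.
have bound_ge0 (r : R) : 0 <= r -> 0 <= gamma ^+ 2 * r * d.
  by move=> r0; rewrite mulr_ge0 // mulr_ge0 // sqr_ge0.
have [_ /(_ _ z2'_out) [_ z2'_le]] := IH _ (perp v t) (bs_basis _ latE).
have z2'_le_d : enorm R (z2' - perp v t) <= gamma ^+ 2 * Num.sqrt n.+1%:R * d.
  apply: (le_trans z2'_le); rewrite ler_wpM2l //.
  by rewrite mulr_ge0 ?sqrtr_ge0 // sqr_ge0.
have : enorm R (z2 - t) ^+ 2 <=
    enorm R (z2' - perp v t) ^+ 2 + enorm R v ^+ 2 / 4.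
  rewrite z2'E perp_cols_mul -perpB -addrA; apply: closest_on_line_le => // c.
  by have := a1_min c; rewrite -!addrA.
move=> z2_sqr; rewrite -ler_sqr ?nnegrE ?enorm_ge0 ?bound_ge0 ?sqrtr_ge0 //.
apply: (le_trans z2_sqr).
(* The squared bound splits as n+2 = (n+1) + 1: the first share pays for the recursive error, the
   second for rounding, as (2 gamma^2 d)^2 / 4 = gamma^4 d^2. *)
rewrite !exprMn (@sqr_sqrtr _ n.+2%:R) // -(natr1 n.+1) mulrDr mulrDl mulr1.
apply: lerD.
  apply: (le_trans (lerXn2r 2 _ _ z2'_le_d));
    rewrite ?nnegrE ?enorm_ge0 ?bound_ge0 ?sqrtr_ge0 //.
  by rewrite !exprMn sqr_sqrtr ?ler0n.
rewrite ler_pdivrMr //.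
apply: (le_trans (lerXn2r 2 _ _ v_lt));
  rewrite ?nnegrE ?enorm_ge0 ?bound_ge0 //.
rewrite !exprMn; lra.
Qed.
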